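(* Let $F:[0,1]\to\mathfrak J$ and let $B_n^{DC}(F,x)$, $n\ge1$, $x\in[0,1]$, be the set-valued Bernstein operators defined by the de Casteljau algorithm with the modified binary average $\tilde\otimes$ (see context). (a) If $F$ is continuous with respect to $d_\mu$, then for any $\varepsilon>0$ there exists $N>0$ such that $d_\mu(F(x),B_n^{DC}(F,x))<\varepsilon$ for all $n\ge N$ and all $x\in[0,1]$. (b) If $d_\mu(F(x),F(y))\le L|x-y|^\nu$ for all $x,y\in[0,1]$, then for all $n\ge1$ and all $x\in[0,1]$, $$d_\mu\big(F(x),B_n^{DC}(F,x)\big)\le L\Big(\frac1n\Big)^{\nu}+L\Big(\frac{x(1-x)}{n}\Big)^{\nu/2}.$$
   Context: Here $\nu>0$, $L\ge0$. Fix $m\ge1$ and let $\mu$ be Lebesgue measure on $\mathbb R^m$. $\mathbb J$ denotes the collection of Jordan measurable subsets of $\mathbb R^m$ (bounded sets whose boundary has Lebesgue measure zero). $\operatorname{ci}(A)$ is the closure of the interior of $A$; a bounded set $A$ is regular compact if $A=\operatorname{ci}(A)$. $\mathfrak J\subset\mathbb J$ is the collection of regular compact sets in $\mathbb J$ (including $\emptyset$), with the metric $d_\mu(A,B)=\mu(A\Delta B)$, $\Delta$ being symmetric difference. A subset-generating function is a map $\Psi:\mathbb J\times[0,1]\to\mathfrak J$ such that for all $A\in\mathbb J$ and $s,t\in[0,1]$: (1) $\Psi(A,t)\subseteq A$ up to a null set, i.e. $\mu(\Psi(A,t)\setminus A)=0$; (2) $\mu(\Psi(A,t))=t\,\mu(A)$;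 (3) $\Psi(A,s)\subseteq\Psi(A,t)$ if $s\le t$. A subset-generating function $\Psi$ is fixed. For $A_0,\dots,A_n\in\mathfrak J$ and nonempty $\chi\subseteq\{0,\dots,n\}$ put $\Omega_\chi=\big(\bigcap_{k\in\chi}A_k\big)\setminus\big(\bigcup_{l\in\{0,\dots,n\}\setminus\chi}A_l\big)$, and $\Omega_\emptyset=\emptyset$. For weights $\alpha_i\in[0,1]$ with $\sum_i\alpha_i=1$, the partition average is $\bigotimes_{i=0}^n\alpha_iA_i:=\bigcup_{\chi\subseteq\{0,\dots,n\}}\Psi\big(\Omega_\chi,\sum_{k\in\chi}\alpha_k\big)\in\mathfrak J$. Modified binary average: given $F$ and $n$, for $A,B\in\mathfrak J$ and $\lambda\in[0,1]$ set $\lambda A\,\tilde\otimes\,(1-\lambda)B:=\bigotimes_{i=0}^{n+2}\beta_iE_i$, where $E_i=F(i/n)$, $\beta_i=0$ for $i=0,\dots,n$, and $E_{n+1}=A$, $\beta_{n+1}=\lambda$, $E_{n+2}=B$, $\beta_{n+2}=1-\lambda$. De Casteljau recursion: for fixed $x\in[0,1]$, $F_i^n=F(i/n)$ for $i=0,\dots,n$; $F_i^k=(1-x)F_i^{k+1}\,\tilde\otimes\,xF_{i+1}^{k+1}$ for $i=0,\dots,k$ and $k=n-1,\dots,0$; and $B_n^{DC}(F,x):=F_0^0$. *)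

(* Defs.v *)
From mathcomp Require Import all_boot all_order all_algebra.
From mathcomp Require Import all_classical all_reals all_analysis.

Set Implicit Arguments.
Unset Strict Implicit.
Unset Printing Implicit Defensive.

Import Order.TTheory GRing.Theory Num.Theory.
Import numFieldNormedType.Exports.

Local Open Scope classical_set_scope.
Local Open Scope ring_scope.

Section Lebesgue.
Context {R : realType} {m : nat}.
Implicit Types (a b : 'rV[R]_m) (A B X : set 'rV[R]_m).

Definition box a b : set 'rV[R]_m :=
  [set x | forall i, a 0 i < x 0 i <= b 0 i].

(* The truncation at 0 gives volume 0 to the empty boxes. *)
Definition box_volume a b : R := \prod_(i < m) Num.max 0 (b 0 i - a 0 i).

(* Lebesgue measure on R^m, as the outer measure induced by the volume of
   boxes. It is total on sets; on Lebesgue measurable sets, in particular on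
   Jordan measurable sets (which need not be Borel), it is the Lebesgue
   measure. *)
Definition lebesgue_mu X : \bar R :=
  ereal_inf [set s | exists a b : nat -> 'rV[R]_m,
    X `<=` \bigcup_k box (a k) (b k) /\
    s = (\sum_(0 <= k <oo) (box_volume (a k) (b k))%:E)%E].

Definition boundary A : set 'rV[R]_m := closure A `\` A°.

Definition jordan_measurable A : Prop :=
  bounded_set A /\ lebesgue_mu (boundary A) = 0%E.

(* [regclosed A] is [closure A° = A]; boundedness is part of
   [jordan_measurable]. *)
Definition regular_jordan A : Prop := jordan_measurable A /\ regclosed A.

Definition dmu A B : \bar R := lebesgue_mu ((A `\` B) `|` (B `\` A)).

(* A map J x [0,1] -> JJ is represented by a total function which is
   constrained only on J x [0,1]; likewise for F : [0,1] -> JJ below. *)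
Definition subset_generating (Psi : set 'rV[R]_m -> R -> set 'rV[R]_m) : Prop :=
  forall A, jordan_measurable A ->
  [/\ forall t, 0 <= t <= 1 -> regular_jordan (Psi A t),
      forall t, 0 <= t <= 1 -> lebesgue_mu (Psi A t `\` A) = 0%E,
      forall t, 0 <= t <= 1 -> lebesgue_mu (Psi A t) = (t%:E * lebesgue_mu A)%E
    & forall s t, 0 <= s <= 1 -> 0 <= t <= 1 -> s <= t ->
        Psi A s `<=` Psi A t].

Definition Omega n (A : 'I_n.+1 -> set 'rV[R]_m) (chi : {set 'I_n.+1}) :
    set 'rV[R]_m :=
  if chi == finset.set0 then set0
  else (\bigcap_(k in [set k | k \in chi]) A k)
       `\` (\bigcup_(l in [set l | l \notin chi]) A l).

Definition partition_average (Psi : set 'rV[R]_m -> R -> set 'rV[R]_m) n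
    (alpha : 'I_n.+1 -> R) (A : 'I_n.+1 -> set 'rV[R]_m) : set 'rV[R]_m :=
  \bigcup_(chi in [set: {set 'I_n.+1}])
    Psi (Omega A chi) (\sum_(k in chi) alpha k).

Definition modified_weights n (lambda : R) (i : 'I_n.+3) : R :=
  if (i <= n)%N then 0
  else if i == n.+1 :> nat then lambda else 1 - lambda.

Definition modified_sets (F : R -> set 'rV[R]_m) n A B (i : 'I_n.+3) :
    set 'rV[R]_m :=
  if (i <= n)%N then F (i%:R / n%:R)
  else if i == n.+1 :> nat then A else B.

(* lambda A (x)~ (1 - lambda) B, relative to the samples F(0/n), ..., F(n/n) *)
Definition modified_average (Psi : set 'rV[R]_m -> R -> set 'rV[R]_m)
    (F : R -> set 'rV[R]_m) n (lambda : R) A B : set 'rV[R]_m :=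
  partition_average Psi (modified_weights lambda) (@modified_sets F n A B).

(* [de_casteljau Psi F n x j i] is F_i^(n - j): j counts the averaging steps
   performed, so that F_i^n is j = 0 and F_0^0 is j = n. *)
Fixpoint de_casteljau (Psi : set 'rV[R]_m -> R -> set 'rV[R]_m)
    (F : R -> set 'rV[R]_m) (n : nat) (x : R) (j i : nat) : set 'rV[R]_m :=
  match j with
  | 0 => F (i%:R / n%:R)
  | j'.+1 => modified_average Psi F n (1 - x)
               (de_casteljau Psi F n x j' i) (de_casteljau Psi F n x j' i.+1)
  end.

Definition bernstein_DC (Psi : set 'rV[R]_m -> R -> set 'rV[R]_m)
    (F : R -> set 'rV[R]_m) (n : nat) (x : R) : set 'rV[R]_m :=
  de_casteljau Psi F n x n 0.

Definition dmu_continuous (F : R -> set 'rV[R]_m) : Prop :=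
  forall x, 0 <= x <= 1 -> forall eps : R, 0 < eps ->
  exists2 delta : R, 0 < delta &
    forall y, 0 <= y <= 1 -> `|x - y| < delta -> (dmu (F x) (F y) < eps%:E)%E.

End Lebesgue.

(* Main.v *)
From HB Require Import structures.
Require Import Defs.
From mathcomp Require Import all_boot all_order all_algebra.
From mathcomp Require Import all_classical all_reals all_analysis.
From mathcomp Require Import ring lra.
Import Order.TTheory GRing.Theory Num.Theory.
Import numFieldNormedType.Exports.
Local Open Scope classical_set_scope.
Local Open Scope ring_scope.

Set Implicit Arguments.
Unset Strict Implicit.
Unset Printing Implicit Defensive.

(** The atoms Omega_chi are Jordan measurable, hence Caratheodory measurable,
    so that mu is additive on them, and Psi(Omega_chi, t) fills the proportion
    t of Omega_chi. Summing over the atoms gives, for each of the averaged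
    sets E_k, d(E_k, average) <= sum_i alpha_i d(E_k, E_i). As the samples
    F(k/n) take part with weight 0 in every step of the de Casteljau algorithm,
    a bound d(F(k/n), F(i/n)) <= c0 + c1 (i - k)^2 for all i propagates through
    the recursion to the expectation of the right-hand side under the binomial
    law of parameters n and x,
    d(F(k/n), B_n(F, x)) <= c0 + c1 ((n x - k)^2 + n x (1 - x)).
    For (a), uniform continuity provides such a quadratic bound. For (b), the
    tangent of the concave function t^(nu/2) at the expectation of the square
    does, when nu <= 2; if nu > 2 then F is constant up to null sets. To get
    the constants of (b) it is essential to take for k/n a node nearest to
    x. *)

(** * Lebesgue outer measure *)

(** Merges countably many box covers into one sequence in the proof of sigma-subadditivity; both
    sides are the unordered sum over all pairs. *)
Lemma nneseries_reindex_pair (R : realType) (a : nat -> nat -> \bar R)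
    (f : nat -> nat * nat) :
  set_bij [set: nat] [set: nat * nat] f -> (forall i j, 0 <= a i j)%E ->
  (\sum_(0 <= k <oo) a (f k).1 (f k).2
   = \sum_(0 <= i <oo) \sum_(0 <= j <oo) a i j)%E.
Proof.
move=> fbij a0; rewrite nneseries_esumT//.
rewrite -(reindex_esum _ _ _ (fun p => a p.1 p.2) fbij).
rewrite [RHS]nneseries_esumT; last by move=> i; exact: nneseries_ge0.
under [RHS]eq_esum => i _ do rewrite nneseries_esumT//.
by rewrite esum_esum//; congr esum; apply/seteqP; split.
Qed.

Section LebesgueOuterMeasure.
Context {R : realType} {m : nat}.
Implicit Types (a b : 'rV[R]_m.+1) (A B X : set 'rV[R]_m.+1).

Lemma box_volume_ge0 a b : 0 <= box_volume a b.
Proof. by apply: prodr_ge0 => i _; rewrite le_max lexx. Qed.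

(** Degenerate boxes pad finite covers to sequences. A coordinate must exist, hence the dimension
    [m.+1]: in dimension 0 every box is the whole space. *)
Lemma box_refl a : box a a = set0.
Proof.
rewrite -subset0 => x /(_ ord0) /andP[ax xa].
by have := lt_le_trans ax xa; rewrite ltxx.
Qed.

Lemma box_volume_refl a : box_volume a a = 0.
Proof. by rewrite /box_volume big_ord_recl subrr maxxx mul0r. Qed.

Lemma nneseries_volume_ge0 (a b : nat -> 'rV[R]_m.+1) :
  (0 <= \sum_(0 <= k <oo) (box_volume (a k) (b k))%:E)%E.
Proof. by apply: nneseries_ge0 => k _ _; rewrite lee_fin box_volume_ge0. Qed.

Lemma lebesgue_mu_le_cover X (a b : nat -> 'rV[R]_m.+1) :
  X `<=` \bigcup_k box (a k) (b k) ->
  (lebesgue_mu X <= \sum_(0 <= k <oo) (box_volume (a k) (b k))%:E)%E.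
Proof. by move=> Xab; apply: ereal_inf_lbound; exists a, b. Qed.

Lemma lebesgue_mu_ge0 X : (0 <= lebesgue_mu X)%E.
Proof.
by apply: le_ereal_inf_tmp => _ [a [b [_ ->]]]; exact: nneseries_volume_ge0.
Qed.

Lemma le_lebesgue_mu :
  {homo @lebesgue_mu R m.+1 : A B / A `<=` B >-> (A <= B)%E}.
Proof.
move=> A B AB; apply: ereal_inf_le_tmp => _ [a [b [Bab ->]]].
by exists a, b; split => //; exact: subset_trans Bab.
Qed.

Lemma lebesgue_mu_box a b : (lebesgue_mu (box a b) <= (box_volume a b)%:E)%E.
Proof.
apply: le_trans (@lebesgue_mu_le_cover _ (fun=> a)
  (fun k => if k is 0 then b else a) _) _; first by move=> x xab; exists 0.
rewrite nneseries_recl//; last by move=> k _; rewrite lee_fin box_volume_ge0.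
by rewrite eseries_cond eseries0 ?adde0// => -[]// k _ _; rewrite box_volume_refl.
Qed.

Lemma lebesgue_mu0 : lebesgue_mu (set0 : set 'rV[R]_m.+1) = 0%E.
Proof.
apply/eqP; rewrite eq_le lebesgue_mu_ge0 andbT -(box_refl 0).
by rewrite (le_trans (lebesgue_mu_box _ _))// box_volume_refl.
Qed.

Lemma lebesgue_mu_near_cover X (e : R) : 0 < e -> lebesgue_mu X != +oo%E ->
  exists a b : nat -> 'rV[R]_m.+1, X `<=` \bigcup_k box (a k) (b k) /\
  (\sum_(0 <= k <oo) (box_volume (a k) (b k))%:E <= lebesgue_mu X + e%:E)%E.
Proof.
move=> e0 Xoo.
have Xfin : lebesgue_mu X \is a fin_num.
  by rewrite ge0_fin_numE ?lebesgue_mu_ge0// ltey.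
have [_ [a [b [Xab ->]]] /ltW abX] := lb_ereal_inf_adherent e0 Xfin.
by exists a, b.
Qed.

Lemma lebesgue_mu_sigma_subadditive : sigma_subadditive (@lebesgue_mu R m.+1).
Proof.
move=> A; have [[i ioo]|Aoo] := pselect (exists i, lebesgue_mu (A i) = +oo%E).
  rewrite (eseries_pinfty _ _ ioo) ?leey// => n _.
  by rewrite -ltNye (lt_le_trans _ (lebesgue_mu_ge0 _)).
apply/lee_addgt0Pr => e e0.
rewrite (le_trans _ (epsilon_trick _ _ (ltW e0)))//; last first.
  by move=> n; exact: lebesgue_mu_ge0.
have /choice[G PG] n : exists g : (nat -> 'rV[R]_m.+1) * (nat -> 'rV[R]_m.+1),
    A n `<=` \bigcup_k box (g.1 k) (g.2 k) /\
    (\sum_(0 <= k <oo) (box_volume (g.1 k) (g.2 k))%:E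
     <= lebesgue_mu (A n) + (e / (2 ^ n.+1)%:R)%:E)%E.
  have /lebesgue_mu_near_cover : 0 < e / (2 ^ n.+1)%:R by rewrite divr_gt0.
  move=> /(_ (A n))[|a [b ?]]; last by exists (a, b).
  by apply: contra_notN Aoo => /eqP; exists n.
have /card_esym/card_set_bijP[f fbij] := card_nat2.
have muG_ge0 i j : (0 <= (box_volume ((G i).1 j) ((G i).2 j))%:E)%E.
  by rewrite lee_fin box_volume_ge0.
apply: le_trans (@lebesgue_mu_le_cover _ (fun k => (G (f k).1).1 (f k).2)
  (fun k => (G (f k).1).2 (f k).2) _) _.
  move=> x [n _ /(PG n).1 [k _ xk]].
  by have [_ _ /(_ (n, k) I)[j _ fj]] := fbij; exists j; rewrite // fj.
rewrite (nneseries_reindex_pair fbij muG_ge0).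
by apply: lee_nneseries => n *; [exact: nneseries_volume_ge0|exact: (PG n).2].
Qed.

HB.instance Definition _ := isOuterMeasure.Build R 'rV[R]_m.+1 lebesgue_mu
  lebesgue_mu0 lebesgue_mu_ge0 le_lebesgue_mu lebesgue_mu_sigma_subadditive.

End LebesgueOuterMeasure.

(** * Caratheodory measurability of boxes, open sets and Jordan measurable sets *)

Section CaratheodoryMeasurability.
Context {R : realType} {m : nat}.
Implicit Types (a b x : 'rV[R]_m.+1) (A B X U : set 'rV[R]_m.+1).
Local Notation mu := (@lebesgue_mu R m.+1).

Definition set_coord x (i : 'I_m.+1) (c : R) : 'rV[R]_m.+1 :=
  \row_j (if j == i then c else x 0 j).

(** The hyperplane where coordinate [i] equals [c] cuts the box in two; if it misses the box, one
    piece is degenerate and the truncation at 0 gives it volume 0. *)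
Lemma box_volume_cut a b i c :
  box_volume a (set_coord b i (Num.min (b 0 i) c)) +
  box_volume (set_coord a i (Num.max (a 0 i) c)) b = box_volume a b.
Proof.
rewrite /box_volume [X in X + _](bigD1 i)//= [X in _ + X](bigD1 i)//=.
rewrite [RHS](bigD1 i)//= !mxE eqxx.
under eq_bigr => j /negbTE ji do rewrite mxE ji.
under [X in _ + _ * X]eq_bigr => j /negbTE ji do rewrite mxE ji.
rewrite -mulrDl; congr (_ * _).
case: (leP (b 0 i) c) => ?; case: (leP (a 0 i) c) => ?;
  by do ![case: (leP 0 _) => ?]; lra.
Qed.

(** Each cover of [X] is cut along the hyperplane into covers of both parts of [X], with the same
    total volume. *)
Lemma caratheodory_halfspace i c :
  caratheodory_measurable mu [set x | x 0 i <= c].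
Proof.
apply: le_caratheodory_measurable => X.
apply: le_ereal_inf_tmp => _ [a [b [Xab ->]]].
under eq_eseriesr => k _ do rewrite -(box_volume_cut (a k) (b k) i c) EFinD.
rewrite nneseriesD; [|by move=> *; rewrite lee_fin box_volume_ge0..].
apply: leeD; apply: lebesgue_mu_le_cover => x [/Xab[k _ xk] /= xic].
  exists k => // j; rewrite mxE; case: eqP => [->|_]; last exact: xk.
  by have /andP[-> /=] := xk i; rewrite le_min xic => ->.
exists k => // j; rewrite mxE; case: eqP => [->|_]; last exact: xk.
have /andP[? ->] := xk i; rewrite andbT gt_max; apply/andP; split => //.
by rewrite ltNge; apply/negP.
Qed.

Local Notation cara := (caratheodory_type mu).

Lemma caratheodory_box a b : caratheodory_measurable mu (box a b).
Proof.
have -> : box a b = \big[setI/setT]_(i < m.+1)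
    (~` [set x | x 0 i <= a 0 i] `&` [set x | x 0 i <= b 0 i]).
  rewrite -bigcap_seq; apply/seteqP; split => x.
    move=> xab i _; have /andP[ax xb] := xab i; split => //=.
    by apply/negP; rewrite -ltNge.
  move=> xab i.
  have [|/= /negP + ->] := xab i; first by rewrite /= mem_index_enum.
  by rewrite -ltNge => ->.
elim/big_ind: _ => [|A B mA mB|i _].
- rewrite -setC0; apply: caratheodory_measurable_setC.
  exact: caratheodory_measurable_set0.
- exact: caratheodory_measurable_setI.
- apply: caratheodory_measurable_setI; last exact: caratheodory_halfspace.
  by apply: caratheodory_measurable_setC; exact: caratheodory_halfspace.
Qed.

(** An open set is the union of the countably many boxes with rational corners inside it. *)
Lemma caratheodory_open U : open U -> caratheodory_measurable mu U.
Proof.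
move=> Uo.
pose rbox (p : 'rV[rat]_m.+1 * 'rV[rat]_m.+1) : set cara :=
  if `[< box (map_mx ratr p.1) (map_mx ratr p.2) `<=` U >]
  then box (map_mx ratr p.1) (map_mx ratr p.2) else set0.
have -> : U = \bigcup_p rbox p.
  apply/seteqP; split => [x Ux|x [p _]]; last first.
    by rewrite /rbox; case: asboolP => // + xp; exact.
  have /nbhs_ballP[e /= e0 xeU] : nbhs x U by rewrite nbhsE; exists U.
  have /choice[p pP] i : exists p : rat, ratr p \in `](x 0 i - e), (x 0 i)[.
    by apply: rat_in_itvoo; rewrite ltrBlDr ltrDl.
  have /choice[q qP] i : exists q : rat, ratr q \in `](x 0 i), (x 0 i + e)[.
    by apply: rat_in_itvoo; rewrite ltrDl.
  exists (\row_i p i, \row_i q i) => //; rewrite /rbox asboolT/=.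
    move=> i; rewrite !mxE.
    have := pP i; have := qP i; rewrite !in_itv/=.
    by move=> /andP[/ltW -> _] /andP[_ ->].
  move=> y yb; apply: xeU; split => // i j; rewrite ord1 -ball_normE/=.
  have := yb j; have := pP j; have := qP j; rewrite !in_itv/= !mxE.
  move=> /andP[_ qx] /andP[xp _] /andP[py yq].
  by rewrite ltr_distl; apply/andP; split; lra.
apply: (@countable_bigcupT_measurable _ cara); first exact: countableP.
move=> p; rewrite /rbox; case: ifP => _; first exact: caratheodory_box.
exact: caratheodory_measurable_set0.
Qed.

(** The set is its interior together with a piece of its boundary, which is null. *)
Lemma caratheodory_jordan A :
  jordan_measurable A -> caratheodory_measurable mu A.
Proof.
move=> [_ bA0].
rewrite -(setDUK (@interior_subset _ A)).
apply: caratheodory_measurable_setU.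
  by apply: caratheodory_open; exact: open_interior.
apply: le_caratheodory_measurable => X /=.
have -> : mu (X `&` (A `\` A°)) = 0%E.
  apply/eqP; rewrite eq_le lebesgue_mu_ge0 andbT -bA0.
  apply: le_lebesgue_mu => x [_ [Ax nAx]]; split => //.
  exact: subset_closure.
by rewrite add0e le_lebesgue_mu//; exact: subIsetl.
Qed.

Lemma lebesgue_mu_bounded A : bounded_set A -> (mu A < +oo)%E.
Proof.
move=> /pinfty_ex_gt0[M _ AM].
apply: (@le_lt_trans _ _ (mu (box (const_mx (- (M + 1))) (const_mx (M + 1))))).
  apply: le_lebesgue_mu => x /AM xM i.
  have : ball (0 : 'rV[R]_m.+1) (M + 1) x.
    by rewrite -ball_normE /= sub0r normrN (le_lt_trans xM)// ltrDl.
  move=> [_ /(_ 0 i)]; rewrite -ball_normE /= !mxE sub0r normrN ltr_norml.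
  by move=> /andP[-> /ltW ->].
by rewrite (le_lt_trans (lebesgue_mu_box _ _))// ltry.
Qed.

End CaratheodoryMeasurability.

(** * Stability of Jordan measurability under unions and differences *)

Section Jordan.
Context {R : realType} {m : nat}.
Implicit Types (A B : set 'rV[R]_m.+1).
Local Notation mu := (@lebesgue_mu R m.+1).

Lemma boundaryC A : boundary (~` A) = boundary A.
Proof.
by rewrite /boundary closure_setC interiorC !setDE setCK setIC.
Qed.

Lemma boundaryU A B : boundary (A `|` B) `<=` boundary A `|` boundary B.
Proof.
move=> x; rewrite /boundary closureU => -[+ nx] => -[Ax|Bx]; [left|right];
  split=> // xi; apply: nx.
  by apply: interiorS xi => y; left.
by apply: interiorS xi => y; right.
Qed.

Lemma boundaryD A B : boundary (A `\` B) `<=` boundary A `|` boundary B.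
Proof.
rewrite -boundaryC setDE setCI setCK => x /boundaryU.
by rewrite boundaryC.
Qed.

Lemma boundary0 : boundary (set0 : set 'rV[R]_m.+1) = set0.
Proof. by rewrite /boundary closure0 set0D. Qed.

Lemma lebesgue_mu_null2 A B X : mu A = 0%E -> mu B = 0%E -> X `<=` A `|` B ->
  mu X = 0%E.
Proof.
move=> A0 B0 XAB; apply/eqP; rewrite eq_le lebesgue_mu_ge0 andbT.
rewrite (le_trans (le_lebesgue_mu XAB))// (le_trans (outer_measureU2 _ _ _))//.
by rewrite /= A0 B0 adde0.
Qed.

Lemma jordan_set0 : jordan_measurable (set0 : set 'rV[R]_m.+1).
Proof.
split; first by apply: nearW => M x.
by rewrite boundary0 lebesgue_mu0.
Qed.

Lemma bounded_subset A B : A `<=` B -> bounded_set B -> bounded_set A.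
Proof.
by move=> AB [M [Mr MB]]; exists M; split => // N /MB BN x /AB; exact: BN.
Qed.

Lemma jordan_setU A B : jordan_measurable A -> jordan_measurable B ->
  jordan_measurable (A `|` B).
Proof.
move=> [Ab A0] [Bb B0]; split.
  have [M _ AM] := pinfty_ex_gt0 Ab; have [N _ BN] := pinfty_ex_gt0 Bb.
  exists (Num.max M N); split => [|K]; first exact: num_real.
  by rewrite gt_max => /andP[MK NK] x [/AM|/BN] /= /le_trans; apply; apply: ltW.
by apply: lebesgue_mu_null2 A0 B0 _; exact: boundaryU.
Qed.

Lemma jordan_setD A B : jordan_measurable A -> jordan_measurable B ->
  jordan_measurable (A `\` B).
Proof.
move=> [Ab A0] [Bb B0]; split; first by apply: bounded_subset Ab => x [].
by apply: lebesgue_mu_null2 A0 B0 _; exact: boundaryD.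
Qed.

End Jordan.

(** * Partition averages *)

Section FiniteUnions.
Context {R : realType} {m : nat} {I : finType}.
Implicit Types (X : set 'rV[R]_m.+1) (F : I -> set 'rV[R]_m.+1) (P : pred I).
Local Notation mu := (@lebesgue_mu R m.+1).

Lemma bigsetU_fin F P :
  \big[setU/set0]_(i | P i) F i = [set x | exists2 i, P i & F i x].
Proof.
rewrite -bigcup_seq_cond; apply/seteqP; split => x /= [i].
  by move=> /andP[_ Pi] Fix; exists i.
by move=> Pi Fix; exists i => //=; rewrite mem_index_enum.
Qed.

Lemma jordan_bigcup F : (forall i, jordan_measurable (F i)) ->
  jordan_measurable (\bigcup_i F i).
Proof.
move=> jF; have -> : \bigcup_i F i = \big[setU/set0]_i F i.
  by rewrite bigsetU_fin; apply/seteqP; split => x [i _ Fx]; exists i.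
by elim/big_ind: _ => // *; [exact: jordan_set0|exact: jordan_setU].
Qed.

Lemma lebesgue_mu_le_sum X F P :
  (forall x, X x -> exists2 i, P i & F i x) ->
  (mu X <= \sum_(i | P i) mu (F i))%E.
Proof.
move=> XF; apply: (@le_trans _ _ (mu (\big[setU/set0]_(i | P i) F i))).
  by apply: le_lebesgue_mu; rewrite bigsetU_fin.
elim/big_ind2: _ => [|A a B b Aa Bb|i _]; [by rewrite lebesgue_mu0| |by []].
by rewrite (le_trans (outer_measureU2 _ _ _))// leeD.
Qed.

Lemma lebesgue_mu_sum X F P :
  (forall i, caratheodory_measurable mu (F i)) ->
  (forall i j x, F i x -> F j x -> i = j) ->
  (forall x, X x <-> exists2 i, P i & F i x) ->
  (mu X = \sum_(i | P i) mu (F i))%E.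
Proof.
move=> mF dF XF.
have -> : X = \big[setU/set0]_(i | P i) F i.
  by rewrite bigsetU_fin; apply/seteqP; split => x /XF.
elim: (index_enum I) (index_enum_uniq I) => [|i s ih /= /andP[nis us]].
  by rewrite !big_nil lebesgue_mu0.
rewrite !big_cons; case: ifP => Pi; last exact: ih.
(* The Caratheodory criterion for [F i] splits it off the union; disjointness leaves the rest
   intact. *)
rewrite (mF i) -ih//; congr (_ + _)%E; congr mu.
  by rewrite setIUl setIid; apply/setUidPl => x [].
rewrite setIUl setICr set0U; apply/setIidPl.
rewrite -bigcup_seq_cond => x [j /= /andP[js _] Fjx] Fix.
by move: nis; rewrite (dF _ _ _ Fix Fjx) js.
Qed.

End FiniteUnions.

(** * The pseudometric [dmu] *)

Section Dmu.
Context {R : realType} {m : nat}.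
Implicit Types (A B C : set 'rV[R]_m.+1).

Lemma dmuxx A : dmu A A = 0%E.
Proof. by rewrite /dmu setDv setU0 lebesgue_mu0. Qed.

Lemma dmu_ge0 A B : (0 <= dmu A B)%E.
Proof. exact: lebesgue_mu_ge0. Qed.

Lemma dmuC A B : dmu A B = dmu B A.
Proof. by rewrite /dmu setUC. Qed.

Lemma dmu_triangle B A C : (dmu A C <= dmu A B + dmu B C)%E.
Proof.
apply: le_trans (outer_measureU2 _ _ _).
apply: le_lebesgue_mu => x.
have [Bx|nBx] := pselect (B x).
  by move=> [[Ax nCx]|[Cx nAx]]; [right; left|left; right].
by move=> [[Ax nCx]|[Cx nAx]]; [left; left|right; right].
Qed.

End Dmu.

(** * Atoms of a finite family and the averaging inequality *)

Section PartitionAverage.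
Context {R : realType} {m n : nat}.
Variables (A : 'I_n.+1 -> set 'rV[R]_m.+1).
Local Notation mu := (@lebesgue_mu R m.+1).
Local Notation index_set := {set 'I_n.+1}.

Lemma OmegaP (chi : index_set) x :
  Omega A chi x <-> chi != finset.set0 /\ forall k, A k x <-> k \in chi.
Proof.
rewrite /Omega; case: eqP => [->|_]; first by split => // -[].
split=> [[Ax nAx]|[_ Ax]]; last first.
  by split=> [k /Ax //|[k /= nk /Ax]]; exact/negP.
split => // k; split => [Akx|/Ax//].
by apply/negPn/negP => nk; apply: nAx; exists k.
Qed.

Lemma Omega_disjoint (chi chi' : index_set) x :
  Omega A chi x -> Omega A chi' x -> chi = chi'.
Proof.
move=> /OmegaP[_ xchi] /OmegaP[_ xchi']; apply/setP => k.
by apply/idP/idP => [/xchi /xchi'|/xchi' /xchi].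
Qed.

Lemma Omega_exists k x :
  A k x -> exists2 chi : index_set, k \in chi & Omega A chi x.
Proof.
move=> Akx; pose chi := [set i | `[< A i x >]]%SET.
have kchi : k \in chi by rewrite inE; apply/asboolP.
exists chi => //; apply/OmegaP; split; first by apply/set0Pn; exists k.
by move=> i; rewrite inE; split => /asboolP.
Qed.

Hypothesis jA : forall i, jordan_measurable (A i).

Lemma jordan_Omega (chi : index_set) : jordan_measurable (Omega A chi).
Proof.
have [->|/set0Pn[k kchi]] := eqVneq chi finset.set0.
  by rewrite /Omega eqxx; exact: jordan_set0.
(* The atom is what remains of [A k] once the points violating the condition of some index [i] are
   removed, so unions and differences suffice. *)
pose G i := if i \in chi then A k `\` A i else A i.
have -> : Omega A chi = A k `\` \bigcup_i G i.
  apply/seteqP; split => x.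
    move=> /OmegaP[_ xchi]; split; first exact/xchi.
    by move=> [i _]; rewrite /G; case: ifPn => [/xchi ? []|/negP ni /xchi].
  move=> [Akx nG]; apply/OmegaP; split; first by apply/set0Pn; exists k.
  move=> i; split=> [Aix|ichi].
    by apply: contra_notT nG => /negbTE ni; exists i; rewrite // /G ni.
  by apply: contra_notP nG => nAix; exists i; rewrite // /G ichi.
apply: jordan_setD => //; apply: jordan_bigcup => i.
by rewrite /G; case: ifP => _ //; exact: jordan_setD.
Qed.

Variable Psi : set 'rV[R]_m.+1 -> R -> set 'rV[R]_m.+1.
Hypothesis hPsi : subset_generating Psi.
Variable alpha : 'I_n.+1 -> R.
Hypotheses (alpha_ge0 : forall i, 0 <= alpha i) (alpha_sum : \sum_i alpha i = 1).

Let beta (chi : index_set) := \sum_(k in chi) alpha k.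

Let beta01 chi : 0 <= beta chi <= 1.
Proof.
rewrite sumr_ge0//= -alpha_sum [leRHS](bigID (mem chi))/= lerDl.
exact: sumr_ge0.
Qed.

Lemma jordan_partition_average :
  jordan_measurable (partition_average Psi alpha A).
Proof.
apply: jordan_bigcup => chi.
by have [/(_ _ (beta01 chi))[]] := hPsi (jordan_Omega chi).
Qed.

(** The symmetric difference is the disjoint union of the atoms lying in exactly one of the two
    sets. *)
Lemma dmu_sum_Omega i k :
  dmu (A k) (A i) =
  (\sum_(chi : index_set | (k \in chi) != (i \in chi)) mu (Omega A chi))%E.
Proof.
apply: lebesgue_mu_sum => [chi|chi chi' x|x].
- exact/caratheodory_jordan/jordan_Omega.
- exact: Omega_disjoint.
split=> [[[Akx Aix]|[Aix Akx]]|[chi ki /OmegaP[_ xchi]]].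
- have [chi kchi xchi] := Omega_exists Akx; exists chi => //.
  by move/OmegaP: xchi => [_ /(_ i) xi]; rewrite kchi; apply/eqP => /esym/xi.
- have [chi kchi xchi] := Omega_exists Aix; exists chi => //.
  by move/OmegaP: xchi => [_ /(_ k) xk]; rewrite kchi; apply/eqP => /xk.
- move: ki; case: (boolP (k \in chi)) => [kchi ichi|kchi].
    by left; split; [exact/xchi|move=> /xchi; exact/negP].
  case: (boolP (i \in chi)) => // ichi _.
  by right; split; [exact/xchi|move=> /xchi; exact/negP].
Qed.

(** On an atom inside [A k] the average misses at most a proportion [1 - beta chi]; on one outside
    it adds at most [beta chi]. Either factor is the total weight of the indices that the atom
    separates from [k], so exchanging the sums over atoms and indices gives the weighted
    distances. *)
Lemma dmu_partition_average k (r : 'I_n.+1 -> R) :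
  (forall i, dmu (A k) (A i) <= (r i)%:E)%E ->
  (dmu (A k) (partition_average Psi alpha A) <= (\sum_i alpha i * r i)%:E)%E.
Proof.
move=> dr; set U := partition_average Psi alpha A.
pose w chi := fine (mu (Omega A chi)).
have wE chi : mu (Omega A chi) = (w chi)%:E.
  rewrite fineK// ge0_fin_numE ?lebesgue_mu_ge0//.
  by apply: lebesgue_mu_bounded; have [] := jordan_Omega chi.
have UA : (mu (U `\` A k) <=
    \sum_(chi : index_set | k \notin chi) (beta chi * w chi)%:E)%E.
  apply: (@le_trans _ _ (\sum_(chi : index_set)
      mu (Psi (Omega A chi) (beta chi) `\` A k)))%E.
    by apply: lebesgue_mu_le_sum => x [[chi _ xchi] nAx]; exists chi.
  rewrite [leRHS]big_mkcond/=; apply: lee_sum => chi _.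
  have [_ /(_ _ (beta01 chi)) PsiO /(_ _ (beta01 chi)) Psit _] :=
    hPsi (jordan_Omega chi).
  case: (boolP (k \in chi)) => /= [kchi|_].
    rewrite -PsiO; apply: le_lebesgue_mu => x [Px nAx]; split => //.
    by move=> /OmegaP[_ xchi]; apply: nAx; exact/xchi.
  by rewrite EFinM -wE -Psit; apply: le_lebesgue_mu => x [].
have AU : (mu (A k `\` U) <=
    \sum_(chi : index_set | k \in chi) ((1 - beta chi) * w chi)%:E)%E.
  apply: (@le_trans _ _ (\sum_(chi : index_set | k \in chi)
      mu (Omega A chi `\` Psi (Omega A chi) (beta chi))))%E.
    apply: lebesgue_mu_le_sum => x [Akx nUx].
    have [chi kchi xchi] := Omega_exists Akx; exists chi => //; split => // xP.
    by apply: nUx; exists chi.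
  apply: lee_sum => chi _.
  have [/(_ _ (beta01 chi))[jP _] /(_ _ (beta01 chi)) PsiO
    /(_ _ (beta01 chi)) Psit _] := hPsi (jordan_Omega chi).
  have wPsi := caratheodory_jordan jP (Omega A chi).
  (* [Psi] lies in the atom only up to a null set, so its trace on the atom still has at least the
     measure of [Psi]. *)
  have : (mu (Psi (Omega A chi) (beta chi)) <=
      mu (Omega A chi `&` Psi (Omega A chi) (beta chi)))%E.
    rewrite (caratheodory_jordan (jordan_Omega chi) (Psi _ _)) -setDE PsiO adde0.
    by rewrite setIC.
  rewrite Psit wE -EFinM => bw.
  rewrite -setDE wE in wPsi.
  rewrite mulrBl mul1r EFinB wPsi leeBrDr// addeC.
  exact: leeD2r.
rewrite (le_trans (outer_measureU2 _ _ _))//.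
rewrite (le_trans (leeD AU UA))//.
rewrite 2!sumEFin -EFinD.
pose d i := \sum_(chi : index_set | (k \in chi) != (i \in chi)) w chi.
have dd i : dmu (A k) (A i) = (d i)%:E.
  by rewrite dmu_sum_Omega -sumEFin; apply: eq_bigr => chi _; rewrite wE.
rewrite lee_fin (@le_trans _ _ (\sum_i alpha i * d i))//; last first.
  by apply: ler_sum => i _; rewrite ler_wpM2l// -lee_fin -dd.
rewrite le_eqVlt; apply/orP; left; apply/eqP.
under [RHS]eq_bigr => i _ do rewrite mulr_sumr big_mkcond.
rewrite exchange_big/= [RHS](bigID (fun chi : index_set => k \in chi))/=.
congr (_ + _); apply: eq_bigr => chi kchi; rewrite -big_mkcond -mulr_suml.
  congr (_ * _); rewrite -alpha_sum (bigID (mem chi))/= addrAC subrr add0r.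
  by apply: eq_bigl => i; rewrite kchi; case: (i \in chi).
by congr (_ * _); apply: eq_bigl => i; rewrite (negbTE kchi); case: (i \in chi).
Qed.

End PartitionAverage.

(** * The de Casteljau algorithm *)

Section DeCasteljau.
Context {R : realType} {m : nat}.
Variable Psi : set 'rV[R]_m.+1 -> R -> set 'rV[R]_m.+1.
Hypothesis hPsi : subset_generating Psi.
Variable F : R -> set 'rV[R]_m.+1.
Variable n : nat.
Hypothesis jF : forall i, (i <= n)%N -> jordan_measurable (F (i%:R / n%:R)).

Lemma sum_modified (lambda a b : R) (r : 'I_n.+3 -> R) :
  (forall i : 'I_n.+3, i = n.+1 :> nat -> r i = a) ->
  (forall i : 'I_n.+3, i = n.+2 :> nat -> r i = b) ->
  \sum_i modified_weights lambda i * r i = lambda * a + (1 - lambda) * b.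
Proof.
move=> ra rb; rewrite 2!big_ord_recr/= big1 => [|i _]; last first.
  by rewrite /modified_weights /= -ltnS ltn_ord mul0r.
rewrite add0r /modified_weights/= ltnn eqxx ltnNge leqnSn/= gtn_eqF//.
by rewrite ra// rb.
Qed.

Lemma jordan_modified_sets A B i : jordan_measurable A -> jordan_measurable B ->
  jordan_measurable (@modified_sets R m.+1 F n A B i).
Proof.
move=> jA jB; rewrite /modified_sets; case: leqP => [/jF //|_].
by case: eqP.
Qed.

Variables (lambda : R) (lambda01 : 0 <= lambda <= 1).

Lemma modified_weights_ge0 (i : 'I_n.+3) : 0 <= modified_weights lambda i.
Proof.
rewrite /modified_weights; do 2?case: ifP => // _; rewrite ?subr_ge0;
  by case/andP: lambda01.
Qed.

Lemma sum_modified_weights : \sum_(i < n.+3) modified_weights lambda i = 1.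
Proof.
under eq_bigr => i _ do rewrite -[modified_weights _ _]mulr1.
by rewrite (@sum_modified _ 1 1) ?mulr1 ?subrKC//.
Qed.

Lemma jordan_modified_average A B :
  jordan_measurable A -> jordan_measurable B ->
  jordan_measurable (modified_average Psi F n lambda A B).
Proof.
move=> jA jB; apply: jordan_partition_average => //.
- by move=> i; exact: jordan_modified_sets.
- exact: modified_weights_ge0.
- exact: sum_modified_weights.
Qed.

(** [F (k / n)] is itself one of the averaged sets, at index [k], so [dmu_partition_average]
    applies; this is what the samples of weight 0 are for. *)
Lemma dmu_modified_average k A B (a b : R) : (k <= n)%N ->
  jordan_measurable A -> jordan_measurable B ->
  (dmu (F (k%:R / n%:R)) A <= a%:E)%E -> (dmu (F (k%:R / n%:R)) B <= b%:E)%E ->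
  (dmu (F (k%:R / n%:R)) (modified_average Psi F n lambda A B)
   <= (lambda * a + (1 - lambda) * b)%:E)%E.
Proof.
move=> kn jA jB Aa Bb.
pose E := @modified_sets R m.+1 F n A B.
have kn3 : (k < n.+3)%N by rewrite ltnS (leq_trans kn)// -addn2 leq_addr.
have Ek : E (Ordinal kn3) = F (k%:R / n%:R) by rewrite /E /modified_sets /= kn.
(* On the samples the bound is multiplied by 0 and only has to be finite; the true distance
   serves. *)
pose r (i : 'I_n.+3) : R :=
  if (i <= n)%N then fine (dmu (F (k%:R / n%:R)) (E i))
  else if i == n.+1 :> nat then a else b.
rewrite -(@sum_modified lambda a b r); last first.
- by move=> i; rewrite /r => ->; rewrite ltnNge leqnSn/= gtn_eqF.
- by move=> i; rewrite /r => ->; rewrite ltnn eqxx.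
rewrite -Ek; apply: dmu_partition_average => //.
- by move=> i; exact: jordan_modified_sets.
- exact: modified_weights_ge0.
- exact: sum_modified_weights.
move=> i; rewrite Ek /r; case: leqP => [iltn|ni].
  rewrite fineK// ge0_fin_numE ?dmu_ge0// lebesgue_mu_bounded//.
  have jE := jordan_modified_sets i jA jB.
  have [] // := jordan_setU (jordan_setD (jF kn) jE) (jordan_setD jE (jF kn)).
by rewrite /E /modified_sets leqNgt ni/=; case: eqP.
Qed.

End DeCasteljau.

Section Bernstein.
Context {R : realType} {m : nat}.
Variable Psi : set 'rV[R]_m.+1 -> R -> set 'rV[R]_m.+1.
Hypothesis hPsi : subset_generating Psi.
Variable F : R -> set 'rV[R]_m.+1.
Variable n : nat.
Hypothesis jF : forall i, (i <= n)%N -> jordan_measurable (F (i%:R / n%:R)).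
Variables (x : R) (x01 : 0 <= x <= 1).

Let onem_x01 : 0 <= 1 - x <= 1.
Proof. by case/andP: x01 => ? ?; apply/andP; lra. Qed.

Lemma jordan_de_casteljau j i : (i + j <= n)%N ->
  jordan_measurable (de_casteljau Psi F n x j i).
Proof.
elim: j i => [|j ih] i ijn /=; first by apply: jF; rewrite -(addn0 i).
by apply: jordan_modified_average => //; apply: ih;
  rewrite ?addSnnS// (leq_trans _ ijn)// addnS.
Qed.

(** With [S] binomial of parameters [j] and [x], the bracket is the expectation of
    [(i + S - k) ^ 2]. One averaging step amounts to conditioning on one trial, so the bound is
    carried over by an identity. *)
Lemma dmu_de_casteljau k (c0 c1 : R) : (k <= n)%N ->
  (forall i, (i <= n)%N ->
    (dmu (F (k%:R / n%:R)) (F (i%:R / n%:R))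
     <= (c0 + c1 * (i%:R - k%:R) ^+ 2)%:E)%E) ->
  forall j i, (i + j <= n)%N ->
  (dmu (F (k%:R / n%:R)) (de_casteljau Psi F n x j i)
   <= (c0 + c1 * ((i%:R + j%:R * x - k%:R) ^+ 2 + j%:R * (x * (1 - x))))%:E)%E.
Proof.
move=> kn dF; elim=> [|j ih] i ijn /=.
  by rewrite !mul0r !addr0; apply: dF; rewrite -(addn0 i).
have ijn' : (i + j <= n)%N by rewrite (leq_trans _ ijn)// addnS.
have ijn'' : (i.+1 + j <= n)%N by rewrite addSnnS.
rewrite (le_trans (dmu_modified_average hPsi jF onem_x01 kn
  (jordan_de_casteljau ijn') (jordan_de_casteljau ijn'')
  (ih _ ijn') (ih _ ijn'')))//.
rewrite lee_fin le_eqVlt; apply/orP; left; apply/eqP.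
by rewrite -(natr1 i) -(natr1 j); ring.
Qed.

(* The mean and the variance of the binomial law are [n x] and [n x (1 - x)]. *)
Lemma dmu_bernstein_DC k (c0 c1 : R) : (k <= n)%N ->
  (forall i, (i <= n)%N ->
    (dmu (F (k%:R / n%:R)) (F (i%:R / n%:R))
     <= (c0 + c1 * (i%:R - k%:R) ^+ 2)%:E)%E) ->
  (dmu (F (k%:R / n%:R)) (bernstein_DC Psi F n x)
   <= (c0 + c1 * ((n%:R * x - k%:R) ^+ 2 + n%:R * (x * (1 - x))))%:E)%E.
Proof.
move=> kn dF; have := @dmu_de_casteljau k c0 c1 kn dF n 0 (leqnn _).
by rewrite add0r.
Qed.

End Bernstein.

(** * Rates of approximation *)

Section RealPowers.
Context {R : realType}.
Implicit Types (p s tau nu z : R).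

(* This is Young's inequality with exponents 1/p and 1/(1-p). *)
Lemma powR_tangent p tau : 0 < p <= 1 -> 0 < tau ->
  exists c : R, forall s, 0 <= s -> s `^ p <= tau `^ p + c * (s - tau).
Proof.
move=> /andP[p0 p1] tau0; exists (p * tau `^ p / tau) => s s0.
have q0 : 0 <= s / tau by rewrite divr_ge0// ltW.
have bern : (s / tau) `^ p <= 1 + p * (s / tau - 1).
  move: p1; rewrite le_eqVlt => /predU1P[->|p1]; first by rewrite powRr1//; lra.
  have := @conjugate_powR _ ((s / tau) `^ p) 1 p^-1 (1 - p)^-1
    (powR_ge0 _ _) ler01.
  rewrite !invr_gt0 subr_gt0 !invrK mulr1 -powRrM mulfV ?gt_eqF//.
  rewrite powRr1// powR1.
  by move=> /(_ p0 p1 (subrKC _ _)); lra.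
have -> : s `^ p = tau `^ p * (s / tau) `^ p.
  by rewrite -powRM// ?(ltW tau0)// mulrC divfK ?gt_eqF.
apply: le_trans (ler_wpM2l (powR_ge0 tau p) bern) _.
rewrite le_eqVlt; apply/orP; left; apply/eqP; field.
by rewrite gt_eqF.
Qed.

(** Concavity: the increment over a step [h] decreases as the starting point moves from [u] to
    [u + a]. *)
Lemma powR_increment p u a h : 0 < p <= 1 -> 0 <= u -> 0 <= a -> 0 <= h ->
  (u + a + h) `^ p + u `^ p <= (u + a) `^ p + (u + h) `^ p.
Proof.
move=> p01 u0; rewrite le_eqVlt => /predU1P[<- _|a0].
  by rewrite addr0 addrC.
rewrite le_eqVlt => /predU1P[<-|h0]; first by rewrite !addr0.
have [c1 t1] := powR_tangent p01 (ltr_wpDl u0 a0).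
have [c2 t2] := powR_tangent p01 (ltr_wpDl u0 h0).
have v0 : 0 <= u + a + h by rewrite !addr_ge0// ltW.
have := t1 _ u0; have := t2 _ u0; have := t1 _ v0; have := t2 _ v0.
set U := u `^ p; set V := (u + a + h) `^ p => V2 V1 U2 U1.
(* [u + a] is the mean of [u] and [u + a + h] with weights [h] and [a], and [u + h] the one with
   weights exchanged; so weighted, the slopes [c1] and [c2] cancel. *)
rewrite -(ler_pM2l (addr_gt0 a0 h0)).
by have := ler_wpM2l (ltW a0) V1; have := ler_wpM2l (ltW h0) V2;
  have := ler_wpM2l (ltW h0) U1; have := ler_wpM2l (ltW a0) U2; lra.
Qed.

Lemma powR_sqr z nu : (z ^+ 2) `^ (nu / 2) = `|z| `^ nu.
Proof.
by rewrite -real_normK ?num_real// -powR_mulrn// -powRrM mulrCA mulfV ?mulr1.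
Qed.

(** Combines both errors, [d] being the distance from [n x] to the nearest integer and [W] the
    variance. [powR_increment] based at [d (1 - d)] separates [W] from [d ^ 2]; what remains is at
    most [d ^ p <= 1], since [d <= 1 - d]. *)
Lemma powR_nearest_bound p d W : 0 < p <= 1 -> 0 <= d -> d <= 2^-1 ->
  d * (1 - d) <= W -> (d ^+ 2) `^ p + (d ^+ 2 + W) `^ p <= 1 + W `^ p.
Proof.
move=> p01 d0 d12 dW; have [p0 _] := andP p01.
have d1 : 0 <= 1 - d by lra.
have W0 : 0 <= W - d * (1 - d) by rewrite subr_ge0.
have := powR_increment p01 (mulr_ge0 d0 d1) (sqr_ge0 d) W0.
have -> : d * (1 - d) + d ^+ 2 + (W - d * (1 - d)) = d ^+ 2 + W by ring.
have -> : d * (1 - d) + d ^+ 2 = d by ring.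
have -> : d * (1 - d) + (W - d * (1 - d)) = W by ring.
rewrite expr2 !powRM// => incr.
have le1 : d `^ p <= 1.
  have one : 1 `^ p = 1 :> R by rewrite powR1.
  by rewrite -[leRHS]one ge0_ler_powR ?nnegrE ?(ltW p0)//; lra.
have led : d `^ p <= (1 - d) `^ p.
  by rewrite ge0_ler_powR ?nnegrE ?(ltW p0)//; lra.
by have := ler_wpM2l (powR_ge0 d p) led; lra.
Qed.

(** The last two bounds compare [k] with the nodes 0 and [n]; they later give
    [d (1 - d) <= n x (1 - x)] for the distance [d]. *)
Lemma nearest_nat (n : nat) (x : R) : 0 <= x <= 1 -> exists k : nat,
  [/\ (k <= n)%N, `|n%:R * x - k%:R| <= 2^-1,
      `|n%:R * x - k%:R| <= n%:R * x & `|n%:R * x - k%:R| <= n%:R - n%:R * x].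
Proof.
move=> /andP[x0 x1].
have y0 : 0 <= n%:R * x by rewrite mulr_ge0.
have yn : n%:R * x <= n%:R by rewrite ler_piMr.
set y := n%:R * x in y0 yn *.
(* Adding 1/2 before truncating rounds to the nearest integer. *)
have /truncn_itv /andP[ky yk] : 0 <= y + 2^-1 by lra.
set k := Num.truncn _ in ky yk.
rewrite -(natr1 k) in yk.
have kn : (k <= n)%N.
  by rewrite -ltnS -(ltr_nat R) -(natr1 n); lra.
exists k; split => //.
- by rewrite ler_norml; apply/andP; split; lra.
- have [k0|k0] := posnP k; first by rewrite k0 subr0 ger0_norm.
  have : 1 <= k%:R :> R by rewrite ler1n.
  by rewrite ler_norml => ?; apply/andP; split; lra.
- move: kn; rewrite leq_eqVlt => /predU1P[->|kn].
    by rewrite distrC ger0_norm// subr_ge0.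
  have : k%:R + 1 <= n%:R :> R by rewrite natr1 ler_nat.
  by rewrite ler_norml => ?; apply/andP; split; lra.
Qed.

(** Such a square is 0 or at least 1. This replaces the tangent when the mean square vanishes. *)
Lemma powR_le_sqr_dist p (i k : nat) : 0 < p <= 1 ->
  ((i%:R - k%:R) ^+ 2) `^ p <= (i%:R - k%:R) ^+ 2 :> R.
Proof.
move=> /andP[p0 p1].
have [->|ik] := eqVneq i k; first by rewrite subrr expr0n/= powR0// gt_eqF.
have : (1 : R) <= (i%:R - k%:R) ^+ 2.
  rewrite -real_normK ?num_real// exprn_ege1//.
  move: ik; rewrite neq_ltn => /orP[] ik; [rewrite distrC|];
    by rewrite ger0_norm ?subr_ge0 ?ler_nat ?(ltnW ik)// lerBrDr addrC natr1
      ler_nat.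
by move=> s1; exact: ler1_powR.
Qed.

End RealPowers.

(** * Chains of short steps and uniform continuity *)

Section Chains.
Context {R : realType} {m : nat}.
Variable F : R -> set 'rV[R]_m.+1.

Lemma dmu_chain (delta e : R) :
  (forall x y, 0 <= x <= 1 -> 0 <= y <= 1 -> `|x - y| <= delta ->
    (dmu (F x) (F y) <= e%:E)%E) ->
  forall (N : nat) x y, 0 <= x <= 1 -> 0 <= y <= 1 -> `|x - y| <= N%:R * delta ->
    (dmu (F x) (F y) <= (N%:R * e)%:E)%E.
Proof.
move=> Fe; elim=> [|N ih] x y x01 y01 xy.
  move: xy; rewrite mul0r normr_le0 subr_eq0 => /eqP ->.
  by rewrite dmuxx mul0r.
have N0 : (0 : R) < N%:R + 1 by rewrite natr1.
have N0' : (0 : R) <= N%:R by [].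
pose t : R := (N%:R + 1)^-1.
have tN : t * (N%:R + 1) = 1 by rewrite mulVf// gt_eqF.
have t0 : 0 <= t by rewrite invr_ge0 ltW.
have t1 : t <= 1 by have := mulr_ge0 t0 N0'; lra.
(* Of [N + 1] equal steps from [x] to [y], the one next to [y] is split off. *)
pose z := y + t * (x - y).
have z01 : 0 <= z <= 1.
  have /andP[x0 x1] := x01; have /andP[y0 y1] := y01.
  by rewrite /z; apply/andP; split; nra.
have zy : `|z - y| <= delta.
  rewrite /z addrAC subrr add0r normrM (ger0_norm t0).
  rewrite (le_trans (ler_wpM2l t0 xy))// -natr1 mulrA tN mul1r lexx//.
have xz : `|x - z| <= N%:R * delta.
  have -> : x - z = (1 - t) * (x - y) by rewrite /z; ring.
  rewrite normrM ger0_norm ?subr_ge0//.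
  have -> : N%:R * delta = (1 - t) * (N.+1%:R * delta).
    by rewrite -natr1 mulrA mulrBl mul1r tN; ring.
  by rewrite ler_wpM2l// subr_ge0.
rewrite (le_trans (dmu_triangle (F z) _ _))//.
rewrite -natr1 mulrDl mul1r EFinD leeD//; first exact: ih.
exact: Fe.
Qed.

(** Heine's theorem, with compactness of the segment in the form of near coverings; halving the
    local radius leaves room to move the centre. *)
Lemma dmu_uniformly_continuous : dmu_continuous F -> forall e : R, 0 < e ->
  exists2 delta : R, 0 < delta & forall x y, 0 <= x <= 1 -> 0 <= y <= 1 ->
    `|x - y| <= delta -> (dmu (F x) (F y) <= e%:E)%E.
Proof.
move=> Fc e e0.
have /compact_near_coveringP cover := @segment_compact R 0 1.
pose P (delta x : R) := 0 <= x <= 1 -> forall y, 0 <= y <= 1 ->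
  `|x - y| <= delta -> (dmu (F x) (F y) <= e%:E)%E.
have : \forall delta \near 0^'+, `[0, 1] `<=` P delta.
  apply: cover => x; rewrite /= in_itv/= => x01.
  have [d d0 Fd] := Fc _ x01 _ (divr_gt0 e0 (ltr0n _ 2)).
  have d20 : 0 < d / 2 by rewrite divr_gt0.
  exists (ball x (d / 2), [set delta | delta < d / 2]).
    by split => /=; [exact: nbhsx_ballx|exact: nbhs_right_lt].
  move=> [x' delta] /= [+ deltad] x'01 y y01 x'y; rewrite /ball/= => xx'.
  rewrite (le_trans (dmu_triangle (F x) _ _))// (splitr e) EFinD leeD//.
    by rewrite dmuC; apply/ltW/Fd => //; lra.
  apply/ltW/Fd => //; rewrite (le_lt_trans (ler_distD x' _ _))//; lra.
move=> near_P.
have [delta [delta0 deltaP]] :=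
  filter_ex (filterI (nbhs_right_gt 0) near_P).
by exists delta => // x y x01 y01; apply: deltaP.
Qed.

End Chains.

(** * Uniform convergence and the Hölder rate *)

Section Convergence.
Context {R : realType} {m : nat}.
Variable Psi : set 'rV[R]_m.+1 -> R -> set 'rV[R]_m.+1.
Hypothesis hPsi : subset_generating Psi.
Variable F : R -> set 'rV[R]_m.+1.
Hypothesis hF : forall x : R, 0 <= x <= 1 -> regular_jordan (F x).

Lemma node01 (n i : nat) : (i <= n)%N -> 0 <= (i%:R / n%:R : R) <= 1.
Proof.
move=> le_in; rewrite divr_ge0//=.
have [->|n0] := posnP n; first by rewrite invr0 mulr0.
by rewrite ler_pdivrMr ?ltr0n// mul1r ler_nat.
Qed.

Lemma jordan_node n i : (i <= n)%N -> jordan_measurable (F (i%:R / n%:R)).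
Proof. by move=> /node01/hF[]. Qed.

Lemma uniform_approximation : dmu_continuous F -> forall eps : R, 0 < eps ->
  exists N : nat, (0 < N)%N /\
    forall n : nat, (N <= n)%N -> forall x : R, 0 <= x <= 1 ->
      (dmu (F x) (bernstein_DC Psi F n x) < eps%:E)%E.
Proof.
(* The final bound consists of two constants [e] and three terms of at most [e / 4], hence is below
   [4 * e]. *)
move=> Fc eps eps0; pose e := eps / 4.
have e0 : 0 < e by rewrite divr_gt0.
have [delta delta0 Fe] := dmu_uniformly_continuous Fc e0.
have d2 : 0 < delta ^+ 2 by rewrite exprn_gt0.
(* Let [t] be the distance in units of [delta]. Up to [t = 1] the constant [e] suffices; beyond, a
   chain of [truncn t + 1] steps does, as [truncn t <= t <= t ^ 2]. *)
have Fsqr x y : 0 <= x <= 1 -> 0 <= y <= 1 ->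
    (dmu (F x) (F y) <= (e + e / delta ^+ 2 * (x - y) ^+ 2)%:E)%E.
  move=> x01 y01; pose t := `|x - y| / delta.
  have t0 : 0 <= t by rewrite divr_ge0// ltW.
  have xyE : `|x - y| = t * delta by rewrite divfK ?gt_eqF.
  have -> : e + e / delta ^+ 2 * (x - y) ^+ 2 = (1 + t ^+ 2) * e.
    rewrite -(real_normK (num_real (x - y))) xyE; field.
    by rewrite gt_eqF.
  have [t1|t1] := leP t 1.
    apply: le_trans (Fe _ _ x01 y01 _) _; first by rewrite xyE ler_piMl// ltW.
    by rewrite lee_fin ler_peMl ?(ltW e0)// lerDl sqr_ge0.
  have /andP[kt tk] := truncn_itv t0.
  apply: le_trans (dmu_chain Fe x01 y01 (N := (Num.truncn t).+1) _) _.
    by rewrite xyE ler_wpM2r ?(ltW delta0)// ltW.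
  rewrite lee_fin ler_wpM2r ?(ltW e0)// -natr1 addrC lerD2l (le_trans kt)//.
  by rewrite expr2 ler_peMl// ltW.
(* Ensures [n * delta ^ 2 >= 1], so that the variance term is at most [e / 4]. *)
pose N := (Num.truncn (delta ^+ 2)^-1).+1.
exists N; split => // n Nn x x01.
have n1 : (1 : R) <= n%:R by rewrite ler1n (leq_trans _ Nn).
have n0 : (0 : R) < n%:R by lra.
have [k [kn y12 _ _]] := nearest_nat n x01.
have nd : (delta ^+ 2)^-1 <= n%:R.
  have /andP[_ /ltW dN] : _ := truncn_itv (ltW (eqbRL (invr_gt0 _) d2)).
  by rewrite (le_trans dN)// ler_nat.
have {}nd : 1 <= n%:R * delta ^+ 2.
  by rewrite -ler_pdivrMr// mul1r.
pose c := e / (delta ^+ 2 * n%:R ^+ 2).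
have c0 : 0 <= c by rewrite ltW// divr_gt0// mulr_gt0// exprn_gt0.
have cn : c * n%:R <= e.
  have -> : c * n%:R = e / (n%:R * delta ^+ 2).
    by rewrite /c; field; rewrite !gt_eqF.
  by rewrite ler_pdivrMr ?ler_peMr ?(ltW e0)// mulr_gt0.
have y14 : (n%:R * x - k%:R) ^+ 2 <= 4^-1.
  have -> : 4^-1 = 2^-1 ^+ 2 :> R by field.
  by rewrite -real_normK ?num_real// lerXn2r ?nnegrE.
have xk : (dmu (F x) (F (k%:R / n%:R)) <= (e + c * (n%:R * x - k%:R) ^+ 2)%:E)%E.
  apply: le_trans (Fsqr _ _ x01 (node01 kn)) _.
  rewrite lee_fin le_eqVlt; apply/orP; left; apply/eqP.
  by rewrite /c; field; rewrite !gt_eqF.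
have kB := @dmu_bernstein_DC _ _ Psi hPsi F n (@jordan_node n) x x01 k e c kn.
rewrite (le_lt_trans (dmu_triangle (F (k%:R / n%:R)) _ _))//.
apply: le_lt_trans (leeD xk (kB _)) _ => [i le_in|].
  apply: le_trans (Fsqr _ _ (node01 kn) (node01 le_in)) _.
  rewrite lee_fin le_eqVlt; apply/orP; left; apply/eqP.
  by rewrite /c; field; rewrite !gt_eqF.
rewrite -EFinD lte_fin.
have x14 : x * (1 - x) <= 4^-1 by have := sqr_ge0 (x - 2^-1); lra.
have cx : c * (n%:R * (x * (1 - x))) <= e * 4^-1.
  have [x0 x1] := andP x01.
  by rewrite mulrA; apply: ler_pM => //;
    apply: mulr_ge0; rewrite ?subr_ge0// ltW.
have cy : c * (n%:R * x - k%:R) ^+ 2 <= e * 4^-1.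
  by apply: ler_pM; rewrite ?sqr_ge0// (le_trans _ cn)// ler_peMr.
by rewrite mulrDr; rewrite /e in cx cy e0 *; lra.
Qed.

(** On distances up to 1 the exponent may be lowered to 2; then [N] steps of length [1 / N] cost at
    most [L / N], which is arbitrarily small. *)
Lemma holder_dmu0 (nu L : R) : 2 < nu -> 0 <= L ->
  (forall x y : R, 0 <= x <= 1 -> 0 <= y <= 1 ->
     (dmu (F x) (F y) <= (L * `|x - y| `^ nu)%:E)%E) ->
  forall x y : R, 0 <= x <= 1 -> 0 <= y <= 1 -> dmu (F x) (F y) = 0%E.
Proof.
move=> nu2 L0 FL x y x01 y01; apply/eqP; rewrite eq_le dmu_ge0 andbT.
apply/lee_addgt0Pr => e e0; rewrite add0e.
pose N := (Num.truncn (L / e)).+1.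
have N0 : (0 : R) < N%:R by [].
have LeN : L <= e * N%:R.
  have /andP[_ /ltW LN] := truncn_itv (divr_ge0 L0 (ltW e0)).
  by rewrite mulrC -ler_pdivrMr.
have step u v : 0 <= u <= 1 -> 0 <= v <= 1 -> `|u - v| <= N%:R^-1 ->
    (dmu (F u) (F v) <= (L * (N%:R^-1) ^+ 2)%:E)%E.
  move=> u01 v01 uv; apply: le_trans (FL _ _ u01 v01) _.
  rewrite lee_fin ler_wpM2l//.
  have uv1 : `|u - v| <= 1 by rewrite (le_trans uv)// invf_le1// ler1n.
  apply: (@le_trans _ _ (`|u - v| `^ 2%:R)).
    have [->|uv0] := eqVneq `|u - v| 0.
      by rewrite !powR0 ?gt_eqF ?(lt_trans _ nu2).
    by apply: ger_powR (ltW nu2); rewrite uv1 andbT lt_def uv0/=.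
  by rewrite powR_mulrn// lerXn2r ?nnegrE// invr_ge0 ltW.
apply: le_trans (dmu_chain step x01 y01 (N := N) _) _.
  rewrite mulfV ?gt_eqF//; case/andP: x01 => ? ?; case/andP: y01 => ? ?.
  by rewrite ler_norml; apply/andP; split; lra.
have -> : N%:R * (L * N%:R^-1 ^+ 2) = L / N%:R by field; rewrite gt_eqF.
by rewrite lee_fin ler_pdivrMr.
Qed.

Lemma holder_rate_le2 (nu L : R) : 0 < nu <= 2 -> 0 <= L ->
  (forall x y : R, 0 <= x <= 1 -> 0 <= y <= 1 ->
     (dmu (F x) (F y) <= (L * `|x - y| `^ nu)%:E)%E) ->
  forall n : nat, (1 <= n)%N -> forall x : R, 0 <= x <= 1 ->
    (dmu (F x) (bernstein_DC Psi F n x)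
     <= (L * (1 / n%:R) `^ nu + L * (x * (1 - x) / n%:R) `^ (nu / 2))%:E)%E.
Proof.
move=> nu02 L0 FL n n1 x x01.
have n0 : (0 : R) < n%:R by rewrite ltr0n.
have p01 : 0 < nu / 2 <= 1 by case/andP: nu02 => ? ?; apply/andP; lra.
have p0 : 0 < nu / 2 by case/andP: p01.
set p := nu / 2 in p01 p0 *.
have [x0 x1] := andP x01; have x1' : 0 <= 1 - x by rewrite subr_ge0.
have [k [kn y12 yy yn]] := nearest_nat n x01.
set K := (1 / n%:R) `^ nu.
have K0 : 0 <= K by exact: powR_ge0.
(* Passes to units of the mesh [1 / n], whose power [K] factors out. *)
have scale (y z : R) : y = (1 / n%:R) ^+ 2 * z -> 0 <= z -> y `^ p = K * z `^ p.
  by move=> -> z0; rewrite powRM ?sqr_ge0// powR_sqr ger0_norm ?divr_ge0.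
set W := n%:R * (x * (1 - x)).
have W0 : 0 <= W by rewrite mulr_ge0 ?(ltW n0)// mulr_ge0.
rewrite (scale _ W) => [| |//]; last by rewrite /W; field; rewrite gt_eqF.
set d := `|n%:R * x - k%:R| in y12 yy yn.
have d0 : 0 <= d by exact: normr_ge0.
have xk : (dmu (F x) (F (k%:R / n%:R)) <= (L * (K * (d ^+ 2) `^ p))%:E)%E.
  apply: le_trans (FL _ _ x01 (node01 kn)) _.
  rewrite lee_fin -powR_sqr (scale ((x - k%:R / n%:R) ^+ 2) (d ^+ 2)) ?sqr_ge0//.
  by rewrite /d real_normK ?num_real//; field; rewrite gt_eqF.
have dk i : (i <= n)%N -> (dmu (F (k%:R / n%:R)) (F (i%:R / n%:R)) <=
    (L * (K * ((i%:R - k%:R) ^+ 2) `^ p))%:E)%E.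
  move=> le_in; apply: le_trans (FL _ _ (node01 kn) (node01 le_in)) _.
  rewrite lee_fin -powR_sqr (scale ((k%:R / n%:R - i%:R / n%:R) ^+ 2)
    ((i%:R - k%:R) ^+ 2)) ?sqr_ge0//.
  by field; rewrite gt_eqF.
(* Jensen's inequality: the tangent at the mean value T is affine in (i - k)^2. *)
pose T := d ^+ 2 + W.
have TE : T = (n%:R * x - k%:R) ^+ 2 + n%:R * (x * (1 - x)).
  by rewrite /T /d real_normK ?num_real.
have kB : (dmu (F (k%:R / n%:R)) (bernstein_DC Psi F n x) <=
    (L * (K * T `^ p))%:E)%E.
  have bern c0 c1 :=
    @dmu_bernstein_DC _ _ Psi hPsi F n (@jordan_node n) x x01 k c0 c1 kn.
  have : 0 <= T by rewrite addr_ge0// sqr_ge0.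
  (* [T = 0] occurs only for [x] equal to 0 or 1; [powR_tangent] needs a positive point, so there
     the squares themselves serve as the bound, with [c0 = 0]. *)
  rewrite le_eqVlt => /predU1P[T0|T0].
    have := bern 0 (L * K); rewrite -TE -T0 powR0 ?gt_eqF// !mulr0 addr0; apply.
    move=> i le_in; apply: le_trans (dk _ le_in) _.
    by rewrite lee_fin add0r mulrA ler_wpM2l ?mulr_ge0// powR_le_sqr_dist.
  have [c cP] := powR_tangent p01 T0.
  have := bern (L * K * (T `^ p - c * T)) (L * K * c); rewrite -TE.
  have -> : L * K * (T `^ p - c * T) + L * K * c * T = L * (K * T `^ p) by ring.
  apply => i le_in; apply: le_trans (dk _ le_in) _.
  rewrite lee_fin; set s := (i%:R - k%:R) ^+ 2.
  have -> : L * K * (T `^ p - c * T) + L * K * c * s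
    = L * (K * (T `^ p + c * (s - T))) by ring.
  by rewrite ler_wpM2l// ler_wpM2l// cP// sqr_ge0.
rewrite (le_trans (dmu_triangle (F (k%:R / n%:R)) _ _))//.
apply: le_trans (leeD xk kB) _.
rewrite -EFinD lee_fin -mulrDr -mulrDr.
have -> : L * K + L * (K * W `^ p) = L * (K * (1 + W `^ p)) by ring.
rewrite ler_wpM2l// ler_wpM2l// powR_nearest_bound//.
(* The product of [n x - d] and [n - n x - d] is nonnegative, so [d (n - d) <= n W]; and
   [n d (1 - d) <= d (n - d)] as [n >= 1]. *)
have WE : n%:R * W = (n%:R * x) * (n%:R - n%:R * x) by rewrite /W; ring.
rewrite -(ler_pM2l n0) WE.
have n1R : (1 : R) <= n%:R by rewrite ler1n.
apply: (@le_trans _ _ (d * (n%:R - d))).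
  by have := ler_wpM2r (sqr_ge0 d) n1R; nra.
by have := mulr_ge0 (eqbRL (subr_ge0 _ _) yy) (eqbRL (subr_ge0 _ _) yn); lra.
Qed.

Lemma holder_rate (nu L : R) : 0 < nu -> 0 <= L ->
  (forall x y : R, 0 <= x <= 1 -> 0 <= y <= 1 ->
     (dmu (F x) (F y) <= (L * `|x - y| `^ nu)%:E)%E) ->
  forall n : nat, (1 <= n)%N -> forall x : R, 0 <= x <= 1 ->
    (dmu (F x) (bernstein_DC Psi F n x)
     <= (L * (1 / n%:R) `^ nu + L * (x * (1 - x) / n%:R) `^ (nu / 2))%:E)%E.
Proof.
move=> nu0 L0 FL n n1 x x01.
have [nu2|nu2] := leP nu 2; first by apply: holder_rate_le2; rewrite ?nu0.
(* All distances between values of [F] vanish, so the recursion propagates the zero bound from the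
   node 0. *)
have F0 := holder_dmu0 nu2 L0 FL.
rewrite (le_trans (dmu_triangle (F (0%:R / n%:R)) _ _))// F0 ?node01// add0e.
have kB := @dmu_bernstein_DC _ _ Psi hPsi F n (@jordan_node n) x x01 0 0 0
  (leq0n n).
apply: le_trans (kB _) _ => [i le_in|].
  by rewrite F0 ?node01// mul0r addr0.
by rewrite lee_fin mul0r addr0 addr_ge0// mulr_ge0// powR_ge0.
Qed.

End Convergence.

Theorem mainTheorem4 (R : realType) (m : nat) (hm : (1 <= m)%N)
    (Psi : set 'rV[R]_m -> R -> set 'rV[R]_m) (hPsi : subset_generating Psi)
    (F : R -> set 'rV[R]_m)
    (hF : forall x : R, 0 <= x <= 1 -> regular_jordan (F x)) :
  (dmu_continuous F ->
   forall eps : R, 0 < eps ->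
   exists N : nat, (0 < N)%N /\
     forall n : nat, (N <= n)%N -> forall x : R, 0 <= x <= 1 ->
       (dmu (F x) (bernstein_DC Psi F n x) < eps%:E)%E)
  /\
  (forall nu L : R, 0 < nu -> 0 <= L ->
   (forall x y : R, 0 <= x <= 1 -> 0 <= y <= 1 ->
      (dmu (F x) (F y) <= (L * `|x - y| `^ nu)%:E)%E) ->
   forall n : nat, (1 <= n)%N -> forall x : R, 0 <= x <= 1 ->
     (dmu (F x) (bernstein_DC Psi F n x)
      <= (L * (1 / n%:R) `^ nu + L * (x * (1 - x) / n%:R) `^ (nu / 2))%:E)%E).
Proof.
case: m hm Psi hPsi F hF => // m _ Psi hPsi F hF.
by split; [exact: uniform_approximation|exact: holder_rate].
Qed.
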